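(* Let $N\ge 1$ and let $K$ be a finite $N$-dimensional simplicial complex that is down $N$-connected. Then the down-signed graph $G_{down}(S_N)$ of $K$ in the maximum dimension $N$ is balanced (i.e. after switching some vertices it is the same as the unsigned down dual graph, with all edge signs positive) if and only if $K$ is orientable.
   Context: $K$ is an abstract simplicial complex on a finite vertex set; $S_d$ denotes the set of its $d$-simplexes (faces with $d+1$ vertices) and $N$ is the maximum dimension of a simplex. For $d\ge 1$, an orientation of a $d$-simplex is an equivalence class of orderings of its vertices modulo even permutations; each such simplex $\sigma$ has two orientations, $[\sigma]$ and $-[\sigma]$ (a $0$-simplex is given a sign $\pm1$ as orientation). The boundary operator is $\partial[i_0,\dots,i_d]=\sum_{j=0}^d(-1)^j[i_0,\dots,i_{j-1},i_{j+1},\dots,i_d]$. For an oriented $d$-simplex $[\sigma]$ and an oriented $(d-1)$-face $[\rho]$ of $\sigma$, $\operatorname{sgn}([\rho],\partial[\sigma])\in\{+1,-1\}$ is $+1$ if the orientation induced by $[\sigma]$ on $\rho$ via $\partial$ agrees with $[\rho]$, and $-1$ otherwise. Down $N$-connected: for every two $N$-simplexes $\sigma,\sigma'$ there is a finite chain of $N$-simplexes from $\sigma$ to $\sigma'$ in which consecutive ones share an $(N-1)$-face. Orientable: an $N$-complex is orientable if there is a choice of orientations of its $N$-simplexes such that any two distinct $N$-simplexes intersecting in an $(N-1)$-simplex induce opposite orientations on that $(N-1)$-simplex. Down-signed graph $G_{down}(S_N)$: fix arbitrary orientations of all $N$- and $(N-1)$-simplexes. The vertices are the (oriented) $N$-simplexes,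 one for each element of $S_N$; two distinct ones $[\sigma],[\sigma']$ are joined by an edge whenever $\sigma,\sigma'$ share an $(N-1)$-face $\rho$, and the sign of this edge is $-\operatorname{sgn}([\rho],\partial[\sigma])\cdot\operatorname{sgn}([\rho],\partial[\sigma'])$. The down dual graph is the underlying graph without signs. Signed graphs: switching a vertex means reversing the signs of all edges incident to it. A signed graph is balanced if, by switching some of its vertices, all signs can be made positive. *)

(* Defs.v *)
From HB Require Import structures.
From mathcomp Require Import all_boot all_order all_algebra all_fingroup.

Set Implicit Arguments.
Unset Strict Implicit.
Unset Printing Implicit Defensive.

Import GRing.Theory.
Local Open Scope ring_scope.

(* Not every point of the ambient type V has to be a vertex of the complex. *)
Record complex (V : finType) := Complex {
  faces :> {set {set V}};
  faces_nonempty : set0 \notin faces;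
  faces_closed : forall A B : {set V},
    A \in faces -> B \subset A -> B != set0 -> B \in faces }.

Section Simplexes.
Variable V : finType.
Implicit Types (K : complex V) (A B : {set V}) (d : nat).

Definition simplexes K d : {set {set V}} := [set A in faces K | #|A| == d.+1].

Definition has_dim K d : Prop :=
  simplexes K d != set0 /\ {in K, forall A, (#|A| <= d.+1)%N}.

Definition share_face K d A B : bool :=
  [exists F in simplexes K d, (F \subset A) && (F \subset B)].

(* Down (d+1)-connectedness: consecutive members of the chain are
   (d+1)-simplexes sharing a d-face. *)
Definition down_connected K d : Prop :=
  {in simplexes K d.+1 &, forall A B,
    connect [rel C D | [&& C \in simplexes K d.+1, D \in simplexes K d.+1
                         & share_face K d C D]] A B}.

End Simplexes.

Section Orientations.
Variable V : finType.
Implicit Types (A F : {set V}) (d : nat).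

Definition reorder d (p : 'S_d) (s : d.-tuple V) : d.-tuple V :=
  [tuple tnth s (p i) | i < d].

Definition is_ordering A d (s : d.-tuple V) : bool :=
  uniq s && ([set x in s] == A).

(* For d = 0 an orientation is a sign, [true] standing for -1 (as in
   [(-1) ^+ b] and [odd_perm]); for d > 0 it is a set of orderings, namely a
   class modulo even permutations (see [is_orientation]). *)
Definition orientation d : finType :=
  match d return finType with
  | 0 => bool
  | d'.+1 => {set d'.+2.-tuple V}
  end.

(* The oriented simplex [i_0, ..., i_d]; a vertex [i_0] gets the sign +1. *)
Definition oriented d : d.+1.-tuple V -> orientation d :=
  match d return d.+1.-tuple V -> orientation d with
  | 0 => fun=> false
  | d'.+1 => fun s =>
      [set t | [exists p : 'S_d'.+2, ~~ odd_perm p && (t == reorder p s)]]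
  end.

Definition opp_orientation d : orientation d -> orientation d :=
  match d return orientation d -> orientation d with
  | 0 => negb
  | d'.+1 => fun o : {set d'.+2.-tuple V} =>
      [set t | [exists s in o,
         [exists p : 'S_d'.+2, odd_perm p && (t == reorder p s)]]]
  end.

Definition is_orientation d : {set V} -> orientation d -> bool :=
  match d return {set V} -> orientation d -> bool with
  | 0 => fun A _ => #|A| == 1%N
  | d'.+1 => fun A o =>
      [exists s : d'.+2.-tuple V, is_ordering A s && (o == oriented s)]
  end.

Definition del_vertex d (j : 'I_d.+1) (s : d.+1.-tuple V) : d.-tuple V :=
  [tuple tnth s (lift j i) | i < d].

(* The term (-1)^j [i_0, .., i_{j-1}, i_{j+1}, .., i_{d+1}] of the boundary of
   [i_0, .., i_{d+1}], as an oriented d-simplex. *)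
Definition boundary_term d (s : d.+2.-tuple V) (j : 'I_d.+2) : orientation d :=
  if odd j then opp_orientation (oriented (del_vertex j s))
  else oriented (del_vertex j s).

(* oF is the orientation induced on the d-face F by the oriented
   (d+1)-simplex oA; any representative s of the class oA gives the same oF. *)
Definition induces d (oA : orientation d.+1) F (oF : orientation d) : bool :=
  [exists s : d.+2.-tuple V, (s \in (oA : {set d.+2.-tuple V})) &&
    [exists j : 'I_d.+2, is_ordering F (del_vertex j s)
                         && (oF == boundary_term s j)]].

Definition sgn_boundary d F (oF : orientation d) (oA : orientation d.+1) : int :=
  if induces oA F oF then 1 else -1.

Definition orients (K : complex V) d (o : {set V} -> orientation d) : Prop :=
  {in simplexes K d, forall A, is_orientation A (o A)}.

(* Orientability of a (d+1)-dimensional complex. *)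
Definition orientable (K : complex V) d : Prop :=
  exists2 o : {set V} -> orientation d.+1, orients K o &
    forall A B, A \in simplexes K d.+1 -> B \in simplexes K d.+1 -> A != B ->
      A :&: B \in simplexes K d ->
      exists2 oF : orientation d, induces (o A) (A :&: B) oF
        & induces (o B) (A :&: B) (opp_orientation oF).

End Orientations.

Section SignedGraphs.
Variable T : finType.

Record signed_graph := SignedGraph {
  edge : rel T;
  sign : T -> T -> int;
  edge_sym : symmetric edge;
  edge_irrefl : irreflexive edge;
  sign_sym : forall x y, edge x y -> sign x y = sign y x;
  sign_val : forall x y, edge x y -> (sign x y == 1) || (sign x y == -1) }.

Implicit Types (G : signed_graph) (x y z : T).

Definition switch_sign G z x y : int :=
  if (x == z) || (y == z) then - sign G x y else sign G x y.

Fact switch_sym G z x y : edge G x y -> switch_sign G z x y = switch_sign G z y x.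
Proof. by move=> xy; rewrite /switch_sign orbC (sign_sym xy). Qed.

Fact switch_val G z x y : edge G x y ->
  (switch_sign G z x y == 1) || (switch_sign G z x y == -1).
Proof.
move=> /sign_val; rewrite /switch_sign; case: ifP => // _.
by rewrite eqr_oppLR eqr_opp orbC.
Qed.

Definition switch G z : signed_graph :=
  SignedGraph (@edge_sym G) (@edge_irrefl G) (@switch_sym G z) (@switch_val G z).

Definition all_positive G : Prop := forall x y, edge G x y -> sign G x y = 1.

Definition balanced G : Prop :=
  exists X : {set T}, all_positive (foldl switch G (enum X)).

End SignedGraphs.

Section DownGraph.
Variables (V : finType) (K : complex V) (d : nat).
Variables (oF : {set V} -> orientation V d) (oA : {set V} -> orientation V d.+1).

Definition down_vertex : finType := {A : {set V} | A \in simplexes K d.+1}.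

Implicit Types u v : down_vertex.

Definition down_edge : rel down_vertex :=
  [rel u v | (u != v) && share_face K d (val u) (val v)].

(* If distinct (d+1)-simplexes share a d-face, that face is their
   intersection. *)
Definition down_sign u v : int :=
  let F := val u :&: val v in
  - (sgn_boundary F (oF F) (oA (val u)) * sgn_boundary F (oF F) (oA (val v))).

Fact down_edge_sym : symmetric down_edge.
Proof.
move=> u v; rewrite /down_edge /= eq_sym; congr (_ && _).
by apply: eq_existsb => F; rewrite [(F \subset _) && _]andbC.
Qed.

Fact down_edge_irrefl : irreflexive down_edge.
Proof. by move=> u; rewrite /down_edge /= eqxx. Qed.

Fact down_sign_sym u v : down_edge u v -> down_sign u v = down_sign v u.
Proof. by move=> _; rewrite /down_sign setIC mulrC. Qed.

Fact down_sign_val u v : down_edge u v ->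
  (down_sign u v == 1) || (down_sign u v == -1).
Proof. by move=> _; rewrite /down_sign /sgn_boundary; do 2!case: ifP. Qed.

Definition down_graph : signed_graph down_vertex :=
  SignedGraph down_edge_sym down_edge_irrefl down_sign_sym down_sign_val.

End DownGraph.

(* Main.v *)
Require Import Defs.
From mathcomp Require Import all_boot all_order all_algebra all_fingroup.

Set Implicit Arguments.
Unset Strict Implicit.
Unset Printing Implicit Defensive.

Import GRing.Theory.
Local Open Scope ring_scope.

(** Choosing an orientation of every top simplex amounts to comparing it with the
    reference orientation oN, hence to choosing the set X of simplexes on which
    it differs.  Reversing the orientation of a simplex negates the signs it
    induces on its facets, so passing from oN to the new orientation multiplies
    the sign of each edge of the down-signed graph exactly as switching the
    vertices of X does.  Finally, because of the minus sign in its definition,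
    the sign of an edge is +1 precisely when its two endpoints induce opposite
    orientations on their common facet.  So X makes all edges positive if and
    only if the corresponding orientation of the complex is coherent.

    What has to be established is that orientations, which are sets of orderings
    (or signs, for points), behave like signs.  Here [flip b o] is the
    orientation o, reversed when b holds.  The orientations of a given simplex
    form a torsor under this action of the group of booleans ([flip_flip],
    [flip_eq], [orientation_flip]).  An oriented simplex induces exactly one
    orientation on each facet, equivariantly for [flip]
    ([induced_orientation]); this rests on the effect of a reordering on a term
    of the boundary ([boundary_term_reorder]), that is, on the identity
    sgn p = (-1)^(j + p j) sgn q for the permutation q obtained from p by
    deleting j from its domain and p j from its codomain
    ([del_vertex_reorder]).  The conclusion for two simplexes is
    [opposite_induced_flipP], and [balancedP] turns the iterated switching into
    a product of signs. *)

(** * Reordering and deleting vertices *)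

Definition flip (V : finType) d (b : bool) (o : orientation V d) :=
  if b then opp_orientation o else o.

Section Reordering.
Variable V : finType.
Implicit Types A F : {set V}.

Lemma reorder1 d (s : d.-tuple V) : reorder 1 s = s.
Proof. by apply: eq_from_tnth => i; rewrite tnth_mktuple perm1. Qed.

Lemma reorderM d (p q : 'S_d) (s : d.-tuple V) :
  reorder p (reorder q s) = reorder (p * q)%g s.
Proof. by apply: eq_from_tnth => i; rewrite !tnth_mktuple permM. Qed.

Lemma reorder_fix d (p : 'S_d) (s : d.-tuple V) :
  uniq s -> reorder p s = s -> p = 1%g.
Proof.
move=> /tuple_uniqP inj_s ps; apply/permP=> i; rewrite perm1.
by apply: inj_s; rewrite -{2}ps tnth_mktuple.
Qed.

Lemma is_ordering_reorder A d (p : 'S_d) (s : d.-tuple V) :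
  is_ordering A s -> is_ordering A (reorder p s).
Proof.
case/andP=> /tuple_uniqP inj_s /eqP <-; apply/andP; split.
  by apply/tuple_uniqP=> i j; rewrite !tnth_mktuple => /inj_s /perm_inj.
apply/eqP/setP=> x; rewrite !inE; apply/tnthP/tnthP=> -[i ->].
  by exists (p i); rewrite tnth_mktuple.
by exists (p^-1 i)%g; rewrite tnth_mktuple permKV.
Qed.

(** The remaining vertices are reordered by the minor q of p at (j, p j), and
    p is the lift of q, whose parity is known. *)
Lemma del_vertex_reorder d (p : 'S_d.+1) (s : d.+1.-tuple V) (j : 'I_d.+1) :
  exists2 q : 'S_d, odd_perm p = odd j (+) odd (p j) (+) odd_perm q
    & del_vertex j (reorder p s) = reorder q (del_vertex (p j) s).
Proof.
have pj_lift i : p j != p (lift j i) by rewrite (inj_eq perm_inj) neq_lift.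
(* As p j != p (lift j i), the default value i is never taken. *)
pose f i := odflt i (unlift (p j) (p (lift j i))).
have fE i : lift (p j) (f i) = p (lift j i).
  by rewrite /f; have [k -> ->] := unlift_some (pj_lift i).
have inj_f : injective f.
  move=> i1 i2 eqf; apply: (@lift_inj _ j); apply: (@perm_inj _ p).
  by rewrite -!fE eqf.
exists (perm inj_f).
  rewrite -odd_lift_perm; congr odd_perm; apply/permP=> i.
  have [k ->|->] := unliftP j i; last by rewrite lift_perm_id.
  by rewrite lift_perm_lift permE fE.
by apply: eq_from_tnth => i; rewrite !tnth_mktuple permE fE.
Qed.

Lemma is_ordering_del_vertex A F d (k : 'I_d.+1) (s : d.+1.-tuple V) :
  is_ordering A s -> is_ordering F (del_vertex k s) = (F == A :\ tnth s k).
Proof.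
case/andP=> /tuple_uniqP inj_s /eqP <-; rewrite /is_ordering.
have -> : uniq (del_vertex k s).
  by apply/tuple_uniqP=> i j; rewrite !tnth_mktuple => /inj_s /lift_inj.
rewrite eq_sym; congr (_ == _); apply/setP=> x; rewrite !inE.
apply/tnthP/andP=> [[i ->]|[neq_xk /tnthP[i xi]]].
  by rewrite tnth_mktuple mem_tnth (inj_eq inj_s) eq_sym neq_lift.
have [j ij|ik] := unliftP k i; last by rewrite xi ik eqxx in neq_xk.
by exists j; rewrite xi ij tnth_mktuple.
Qed.

End Reordering.

(** * Orientations as signs *)

Section OrientationSigns.
Variable V : finType.
Implicit Types A F : {set V}.

Lemma mem_flip_oriented d b (s t : d.+2.-tuple V) :
  reflect (exists2 p : 'S_d.+2, odd_perm p = b & t = reorder p s)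
          (t \in (flip b (oriented s : orientation V d.+1)
                  : {set d.+2.-tuple V})).
Proof.
case: b; rewrite inE.
  apply: (iffP existsP) => [[r /andP[]]|[p odd_p ->]].
    rewrite inE => /existsP[q /andP[/negPf ev_q /eqP->]].
    move=> /existsP[p /andP[odd_p /eqP->]]; exists (p * q)%g.
      by rewrite odd_permM odd_p ev_q.
    by rewrite reorderM.
  exists s; apply/andP; split.
    by rewrite inE; apply/existsP; exists 1%g; rewrite odd_perm1 reorder1 eqxx.
  by apply/existsP; exists p; rewrite odd_p eqxx.
apply: (iffP existsP) => -[p].
  by case/andP=> /negPf ev_p /eqP->; exists p.
by move=> ev_p ->; exists p; rewrite ev_p eqxx.
Qed.

(** This also holds for points, for which every permutation is even. *)
Lemma oriented_reorder d (q : 'S_d.+1) (s : d.+1.-tuple V) :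
  oriented (reorder q s) = flip (odd_perm q) (oriented s).
Proof.
case: d q s => [|d] q s.
  have ->: q = 1%g by apply/permP=> i; rewrite [q i]ord1 perm1 [i]ord1.
  by rewrite odd_perm1.
apply/setP=> t; apply/(mem_flip_oriented false)/mem_flip_oriented.
  case=> p ev_p ->; exists (p * q)%g; last by rewrite reorderM.
  by rewrite odd_permM ev_p.
case=> p odd_p ->; exists (p * q^-1)%g; last by rewrite reorderM mulgKV.
by rewrite odd_permM odd_permV odd_p addbb.
Qed.

Lemma ex_odd_perm d b : exists p : 'S_d.+2, odd_perm p = b.
Proof.
exists (if b then tperm ord0 ord_max else 1%g).
by case: b; rewrite ?odd_perm1 ?odd_tperm.
Qed.

(** Composing twice with an odd permutation does not change the parity; this
    needs two vertices, points being dealt with by the involution on signs. *)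
Lemma oriented_oppK d (s : d.+1.-tuple V) :
  opp_orientation (opp_orientation (oriented s)) = oriented s.
Proof.
case: d s => [//|d] s; have [q odd_q] := ex_odd_perm d true.
have oppE (r : d.+2.-tuple V) :
    opp_orientation (oriented r : orientation V d.+1) = oriented (reorder q r).
  by rewrite oriented_reorder odd_q.
by rewrite !oppE reorderM oriented_reorder odd_permM odd_q.
Qed.

(** The two parity classes are disjoint because the permutation relating two
    orderings of distinct vertices is unique. *)
Lemma oriented_opp_neq d (s : d.+1.-tuple V) :
  uniq s -> opp_orientation (oriented s) != oriented s.
Proof.
case: d s => [//|d] s uniq_s; apply/eqP=> eq_opp.
have: s \in (oriented s : {set d.+2.-tuple V}).
  by apply/(mem_flip_oriented false); exists 1%g; rewrite ?odd_perm1 ?reorder1.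
rewrite -[oriented s]eq_opp => /(mem_flip_oriented true)[p odd_p].
by move/esym/(reorder_fix uniq_s) => p1; rewrite p1 odd_perm1 in odd_p.
Qed.

(** The boolean b is only there for points, whose orientation -1 is not of the
    form [oriented s]; it allows the sequel to treat all dimensions alike. *)
Lemma is_orientation_ordering A d (o : orientation V d) :
  is_orientation A o ->
  exists b, exists2 s : d.+1.-tuple V, is_ordering A s & o = flip b (oriented s).
Proof.
case: d o => [|d] o.
  move=> /cards1P[x ->]; exists o, [tuple x]; last by case: o.
  by apply/andP; split=> //; apply/eqP/setP=> y; rewrite !inE.
by case/existsP=> s /andP[sA /eqP->]; exists false, s.
Qed.

Lemma is_orientation_flip_oriented A d (s : d.+1.-tuple V) b :
  is_ordering A s -> is_orientation A (flip b (oriented s)).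
Proof.
case: d s => [|d] s sA.
  by case/andP: sA => us /eqP <-; rewrite /= cardsE (card_uniqP us) size_tuple.
have [q odd_q] := ex_odd_perm d b; rewrite -odd_q -oriented_reorder.
by apply/existsP; exists (reorder q s); rewrite is_ordering_reorder ?eqxx.
Qed.

Lemma is_orientation_oriented A d (s : d.+1.-tuple V) :
  is_ordering A s -> is_orientation A (oriented s).
Proof. exact: (is_orientation_flip_oriented false). Qed.

Lemma flip_flip A d (o : orientation V d) b c :
  is_orientation A o -> flip b (flip c o) = flip (b (+) c) o.
Proof.
case/is_orientation_ordering=> a [s _ ->].
by case: a b c => -[] [] //=; rewrite /= ?oriented_oppK.
Qed.

Lemma flip_eq A d (o : orientation V d) b c :
  is_orientation A o -> (flip b o == flip c o) = (b == c).
Proof.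
case/is_orientation_ordering=> a [s /andP[/oriented_opp_neq/negPf neq_s _] ->].
by case: a b c => -[] []; rewrite /flip /= ?oriented_oppK ?eqxx ?neq_s //
  eq_sym neq_s.
Qed.

Lemma flip_id A d (o : orientation V d) b :
  is_orientation A o -> (flip b o == o) = ~~ b.
Proof. by move/(flip_eq b false)=> ->; case: b. Qed.

Lemma is_orientation_flip A d (o : orientation V d) b :
  is_orientation A o -> is_orientation A (flip b o).
Proof.
case/is_orientation_ordering=> a [s sA ->].
have sO := is_orientation_oriented sA.
by rewrite (flip_flip _ _ sO) is_orientation_flip_oriented.
Qed.

Lemma ordering_reorder A d (s t : d.-tuple V) :
  is_ordering A s -> is_ordering A t -> exists p : 'S_d, t = reorder p s.
Proof.
case/andP=> us /eqP sA /andP[ut /eqP tA].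
have /tuple_permP[p def_t] : perm_eq t s.
  by apply: uniq_perm => // x; have := in_set (mem s) x; rewrite sA -tA inE.
by exists p; apply: val_inj.
Qed.

Lemma orientation_flip A d (o1 o2 : orientation V d) :
  is_orientation A o1 -> is_orientation A o2 -> exists b, o2 = flip b o1.
Proof.
case/is_orientation_ordering=> a [s sA ->].
case/is_orientation_ordering=> b [t tA ->].
have [p ->] := ordering_reorder sA tA; exists (b (+) odd_perm p (+) a).
have sO := is_orientation_oriented sA.
by rewrite oriented_reorder !(flip_flip _ _ sO) addbK.
Qed.

End OrientationSigns.

(** * Induced orientations *)

Section InducedOrientation.
Variable V : finType.
Implicit Types A F : {set V}.

Lemma boundary_termE d (s : d.+2.-tuple V) (j : 'I_d.+2) :
  boundary_term s j = flip (odd j) (oriented (del_vertex j s)).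
Proof. by []. Qed.

(** Well-definedness of the boundary on orientations: even reorderings give the
    same term, odd ones the opposite term. *)
Lemma boundary_term_reorder d (p : 'S_d.+2) (s : d.+2.-tuple V) (j : 'I_d.+2) :
  uniq s ->
  boundary_term (reorder p s) j = flip (odd_perm p) (boundary_term s (p j)).
Proof.
move=> us; have [q odd_p del_p] := del_vertex_reorder p s j.
rewrite !boundary_termE del_p oriented_reorder.
have sA : is_ordering [set x in s] s by rewrite /is_ordering us eqxx.
have:= is_ordering_del_vertex ([set x in s] :\ tnth s (p j)) (p j) sA.
rewrite eqxx => /is_orientation_oriented-delO.
rewrite !(flip_flip _ _ delO); congr flip; rewrite odd_p.
by case: (odd j) (odd (p j)) (odd_perm q) => -[] [].
Qed.

(** Whatever representative is chosen in the class, the vertex to delete is the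
    one outside the facet, so that [boundary_term_reorder] determines the
    induced orientation from s alone. *)
Lemma induces_oriented A d (s : d.+2.-tuple V) k b (oF : orientation V d) :
  is_ordering A s ->
  induces (flip b (oriented s : orientation V d.+1)) (A :\ tnth s k) oF
    = (oF == flip b (boundary_term s k)).
Proof.
move=> sA; have /andP[us /eqP As] := sA; have /tuple_uniqP inj_s := us.
apply/existsP/eqP=> [[t /andP[/mem_flip_oriented[p odd_p ->]]]|->].
  case/existsP=> j /andP[].
  rewrite (is_ordering_del_vertex _ _ (is_ordering_reorder p sA)).
  rewrite tnth_mktuple => /eqP eq_del /eqP->.
  rewrite boundary_term_reorder // odd_p; congr (flip _ (boundary_term _ _)).
  apply: inj_s; apply/eqP; have: tnth s (p j) \notin A :\ tnth s k.
    by rewrite eq_del setD11.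
  by rewrite !inE -As inE mem_tnth andbT negbK.
(* The vertex of index k in s has index p^-1 k in the reordered simplex. *)
have [p odd_p] := ex_odd_perm d b; exists (reorder p s); apply/andP; split.
  by apply/mem_flip_oriented; exists p.
apply/existsP; exists (p^-1 k)%g.
rewrite (is_ordering_del_vertex _ _ (is_ordering_reorder p sA)).
by rewrite tnth_mktuple permKV eqxx boundary_term_reorder // permKV odd_p eqxx.
Qed.

Lemma induced_orientation A F d (oA : orientation V d.+1) :
  is_orientation A oA -> F \subset A -> #|F| = d.+1 ->
  exists2 o : orientation V d, is_orientation F o
    & forall b oF, induces (flip b oA) F oF = (oF == flip b o).
Proof.
case/existsP=> s /andP[sA /eqP->] sFA cardF; have /andP[us /eqP As] := sA.
have [x DF] : exists x, A :\: F = [set x].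
  apply/cards1P; rewrite cardsD (setIidPr sFA) cardF -As cardsE.
  by rewrite (card_uniqP us) size_tuple subSnn.
have FE : F = A :\ x by rewrite -DF setDDr setDv set0U (setIidPr sFA).
have : x \in A by have := set11 x; rewrite -DF => /setDP[].
rewrite -As inE => /tnthP[k xk]; rewrite xk in FE.
have delF: is_ordering F (del_vertex k s).
  by rewrite (is_ordering_del_vertex _ _ sA) FE.
exists (boundary_term s k) => [|b oF].
  exact: (is_orientation_flip_oriented (odd k)).
by rewrite FE induces_oriented.
Qed.

Lemma sgn_boundary_flip A F d (oA : orientation V d.+1) (oF : orientation V d) b :
  is_orientation A oA -> is_orientation F oF -> F \subset A -> #|F| = d.+1 ->
  sgn_boundary F oF (flip b oA) = (-1) ^+ b * sgn_boundary F oF oA.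
Proof.
move=> orA orF sFA cardF.
have [o orO indE] := induced_orientation orA sFA cardF.
have [c ->] := orientation_flip orO orF.
have ind0 oF' : induces oA F oF' = (oF' == o) := indE false oF'.
rewrite /sgn_boundary indE ind0 (flip_eq _ _ orO) (flip_id _ orO).
by case: b c => -[].
Qed.

(** Relative to the reference orientation of F, the induced orientations are
    two signs; they are opposite exactly when their product is -1. *)
Lemma opposite_inducedP A B F d (oA oB : orientation V d.+1)
    (oF : orientation V d) :
  is_orientation A oA -> is_orientation B oB -> is_orientation F oF ->
  F \subset A -> F \subset B -> #|F| = d.+1 ->
  (exists2 o : orientation V d, induces oA F o
     & induces oB F (opp_orientation o))
  <-> - (sgn_boundary F oF oA * sgn_boundary F oF oB) = 1.
Proof.
move=> orA orB orF sFA sFB cardF.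
have [a oa indA] := induced_orientation orA sFA cardF.
have [b ob indB] := induced_orientation orB sFB cardF.
have {}indA o : induces oA F o = (o == a) := indA false o.
have {}indB o : induces oB F o = (o == b) := indB false o.
have [ca Da] := orientation_flip orF oa; have [cb Db] := orientation_flip orF ob.
have sgnE c : (oF == flip c oF) = ~~ c.
  by rewrite eq_sym (flip_id _ orF).
rewrite /sgn_boundary indA indB Da Db !sgnE.
have oppE c : opp_orientation (flip c oF) = flip (~~ c) oF.
  by rewrite -[LHS]/(flip true _) (flip_flip _ _ orF).
split=> [[o]|].
  rewrite indA indB Da Db => /eqP->; rewrite oppE (flip_eq _ _ orF).
  by case: ca cb {Da Db} => -[].
move=> sgn1; exists a; rewrite ?indA ?indB ?eqxx //.
rewrite Da Db oppE (flip_eq _ _ orF).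
by move: sgn1; case: ca cb {Da Db} => -[].
Qed.

(** Reversing orientations is switching: the right-hand side is the sign of an
    edge once its endpoints with a (resp. b) set have been switched. *)
Lemma opposite_induced_flipP A B F d (oA oB : orientation V d.+1)
    (oF : orientation V d) a b :
  is_orientation A oA -> is_orientation B oB -> is_orientation F oF ->
  F \subset A -> F \subset B -> #|F| = d.+1 ->
  (exists2 o : orientation V d, induces (flip a oA) F o
     & induces (flip b oB) F (opp_orientation o))
  <-> (-1) ^+ a * (-1) ^+ b
      * - (sgn_boundary F oF oA * sgn_boundary F oF oB) = 1 :> int.
Proof.
move=> orA orB orF sFA sFB cF.
rewrite mulrN mulrACA -(sgn_boundary_flip _ orA) // -(sgn_boundary_flip _ orB) //.
by apply: (opposite_inducedP _ _ orF sFA sFB cF); apply: is_orientation_flip.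
Qed.

End InducedOrientation.

(** * Switching signed graphs *)

Section Switching.
Variable T : finType.
Implicit Types (G : signed_graph T) (X : {set T}).

Lemma edge_foldl_switch G s : edge (foldl (@switch T) G s) = edge G.
Proof. by elim: s G => //= z s IHs G; rewrite IHs. Qed.

Lemma sign_foldl_switch G s x y : uniq s -> x != y ->
  sign (foldl (@switch T) G s) x y
    = (-1) ^+ (x \in s) * (-1) ^+ (y \in s) * sign G x y.
Proof.
move=> + neq_xy; elim: s G => [|z s IHs] G /=; first by rewrite !mul1r.
case/andP=> z_s us; rewrite IHs //= /switch_sign !inE.
have [xz|_] := eqVneq x z.
  rewrite -xz in z_s *; rewrite eq_sym (negPf neq_xy) (negPf z_s) /=.
  by rewrite mulrN !mulNr.
have [yz|_] //= := eqVneq y z.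
by rewrite -yz in z_s *; rewrite (negPf z_s) /= mulrN mulrN !mulNr.
Qed.

(** Switching all the vertices of X negates exactly the edges with one endpoint
    in X, since an edge within X is negated twice. *)
Lemma balancedP G :
  balanced G <-> exists X, forall x y, edge G x y ->
    (-1) ^+ (x \in X) * (-1) ^+ (y \in X) * sign G x y = 1.
Proof.
have neq x y : edge G x y -> x != y.
  by apply: contraTneq => ->; rewrite edge_irrefl.
split=> -[X posX]; exists X => x y.
  move=> xy; rewrite -[RHS](posX x y) ?edge_foldl_switch //.
  by rewrite sign_foldl_switch ?enum_uniq ?neq // !mem_enum.
rewrite edge_foldl_switch => xy.
by rewrite sign_foldl_switch ?enum_uniq ?neq // !mem_enum; apply: posX.
Qed.

End Switching.

(** * The down-signed graph and orientability *)

(** A common facet lies in the intersection, which has no room for anything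
    else since it is a proper subset of both simplexes. *)
Lemma share_faceE (V : finType) (K : complex V) d (A B : {set V}) :
  A \in simplexes K d.+1 -> B \in simplexes K d.+1 -> A != B ->
  share_face K d A B = (A :&: B \in simplexes K d).
Proof.
move=> KA KB neqAB; apply/existsP/idP => [[F]|KI]; last first.
  by exists (A :&: B); rewrite KI subsetIl subsetIr.
case/andP=> KF; rewrite -subsetI => sFI; suff <-: F = A :&: B by [].
move: KA KB KF; rewrite !inE => /andP[_ /eqP cA] /andP[_ /eqP cB] /andP[_ /eqP cF].
apply/eqP; rewrite eqEcard sFI cF -ltnS -cA proper_card // properEneq subsetIl.
rewrite andbT; apply: contraNneq neqAB => /setIidPl sAB.
by rewrite eqEcard sAB cA cB leqnn.
Qed.

(* The dimension of K is N = n.+1; oM and oN are the fixed orientations of the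
   (N-1)-simplexes and of the N-simplexes. *)
Theorem lemma3p8 (V : finType) (K : complex V) (n : nat)
    (oM : {set V} -> orientation V n) (oN : {set V} -> orientation V n.+1) :
  has_dim K n.+1 -> down_connected K n ->
  orients K oM -> orients K oN ->
  balanced (down_graph K oM oN) <-> orientable K n.
Proof.
move=> _ _ orM orN.
have cardI A B : A :&: B \in simplexes K n -> #|A :&: B| = n.+1.
  by rewrite inE => /andP[_ /eqP].
apply: (iff_trans (balancedP _)); split=> [[X posX]|[o oO coh]].
  pose f A := A \in [set val u | u in X].
  have fE u : f (val u) = (u \in X) by rewrite /f mem_imset //; apply: val_inj.
  exists (fun A => flip (f A) (oN A)) => [A /orN|A B KA KB neqAB KI].
    exact: is_orientation_flip.
  apply/(opposite_induced_flipP _ _ (orN _ KA) (orN _ KB) (orM _ KI)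
           (subsetIl A B) (subsetIr A B) (cardI _ _ KI)).
  pose u : down_vertex K n := exist _ A KA.
  pose v : down_vertex K n := exist _ B KB.
  rewrite (fE u) (fE v); apply: posX.
  apply/andP; split; last by rewrite share_faceE.
  by apply: contraNneq neqAB => /(congr1 val) /= ->.
pose f A := o A != oN A.
have oE A : A \in simplexes K n.+1 -> o A = flip (f A) (oN A).
  move=> KA; rewrite /f; have [b ->] := orientation_flip (orN _ KA) (oO _ KA).
  by rewrite (flip_id _ (orN _ KA)) negbK.
exists [set u | f (val u)] => u v /andP[neq_uv sh_uv]; rewrite !inE.
have [KA KB] := (valP u, valP v).
have KI : val u :&: val v \in simplexes K n by rewrite -share_faceE.
apply/(opposite_induced_flipP _ _ (orN _ KA) (orN _ KB) (orM _ KI)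
         (subsetIl _ _) (subsetIr _ _) (cardI _ _ KI)).
by rewrite -!oE //; apply: coh.
Qed.
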